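(* Let $I$ be an infinite set and let $\{X_i\}_{i\in I}$ and $\{Y_i\}_{i\in I}$ be families of non-zero complex vector spaces. Let $$\Psi:\bigotimes_{i\in I}L(X_i;Y_i)\longrightarrow L\Big(\bigotimes_{i\in I}X_i;\bigotimes_{i\in I}Y_i\Big)$$ be the canonical linear map given by the universal property of the tensor product, i.e. the linear map determined by $\Psi(\otimes_{i\in I}T_i)(\otimes_{i\in I}x_i)=\otimes_{i\in I}T_ix_i$ for all $T\in\prod_{i\in I}L(X_i;Y_i)$ and $x\in\prod_{i\in I}X_i$. Then $\Psi$ is injective.
   Context: $L(X;Y)$ denotes the vector space of linear maps from $X$ to $Y$. A map on $\prod_{i\in I}X_i$ is multilinear if it is linear in each variable separately. The tensor product of a family $\{X_i\}_{i\in I}$ of vector spaces is a pair $(\bigotimes_{i\in I}X_i,\Theta_X)$ consisting of a vector space and a multilinear map $\Theta_X:\prod_{i\in I}X_i\to\bigotimes_{i\in I}X_i$ such that every multilinear map $\Phi$ from $\prod_{i\in I}X_i$ to a vector space $Y$ is of the form $\tilde\Phi\circ\Theta_X$ for a unique linear map $\tilde\Phi:\bigotimes_{i\in I}X_i\to Y$; it exists and is unique up to canonical isomorphism. Write $\otimes_{i\in I}x_i=\Theta_X(x)$ for $x\in\prod_{i\in I}X_i$. *)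

(* Defs.v *)
From HB Require Import structures.
From mathcomp Require Import all_boot all_order all_algebra.
From mathcomp Require Import all_classical reals prodnormedzmodule complex.

Set Implicit Arguments.
Unset Strict Implicit.
Unset Printing Implicit Defensive.

Import GRing.Theory.
Local Open Scope ring_scope.

Section LinearMaps.
Variables (K : comNzRingType) (U V : lmodType K).
Implicit Types f g h : {linear U -> V}.

Lemma linear_ext f g : f =1 g -> f = g.
Proof.
case: f g => [f [[fD] [fZ]]] [g [[gD] [gZ]]] /= /funext fg.
case: g / fg in gD gZ *.
by rewrite (Prop_irrelevance fD gD) (Prop_irrelevance fZ gZ).
Qed.

Definition linear_add f g : {linear U -> V} := f \+ g.
Definition linear_opp f : {linear U -> V} := \- f.
Definition linear_scale (a : K) f : {linear U -> V} := a \*: f.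

Let addA : associative linear_add.
Proof. by move=> f g h; apply: linear_ext => x /=; rewrite addrA. Qed.
Let addC : commutative linear_add.
Proof. by move=> f g; apply: linear_ext => x /=; rewrite addrC. Qed.
Let add0 : left_id (\0 : {linear U -> V}) linear_add.
Proof. by move=> f; apply: linear_ext => x /=; rewrite add0r. Qed.
Let addN : left_inverse (\0 : {linear U -> V}) linear_opp linear_add.
Proof. by move=> f; apply: linear_ext => x /=; rewrite addNr. Qed.

HB.instance Definition _ :=
  GRing.isZmodule.Build {linear U -> V} addA addC add0 addN.

Let scaleA a b f : linear_scale a (linear_scale b f) = linear_scale (a * b) f.
Proof. by apply: linear_ext => x /=; rewrite scalerA. Qed.
Let scale1 : left_id 1 linear_scale.
Proof. by move=> f; apply: linear_ext => x /=; rewrite scale1r. Qed.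
Let scaleDr : right_distributive linear_scale +%R.
Proof. by move=> a f g; apply: linear_ext => x /=; rewrite scalerDr. Qed.
Let scaleDl f : {morph linear_scale^~ f : a b / a + b}.
Proof. by move=> a b; apply: linear_ext => x /=; rewrite scalerDl. Qed.

HB.instance Definition _ :=
  GRing.Zmodule_isLmodule.Build K {linear U -> V} scaleA scale1 scaleDr scaleDl.

End LinearMaps.

Section TensorProduct.
Variables (K : fieldType) (I : Type) (X : I -> lmodType K).

(* [{classic I}] only supplies the decidable equality needed to replace the
   [i]-th coordinate of [x] by [v]. *)
Definition multilinear (W : lmodType K) (Phi : (forall i, X i) -> W) : Prop :=
  forall (x : forall i, X i) (i : I),
    linear (fun v : X i => Phi (dfwith (I := {classic I}) x i v)).

Definition is_tensor_product (T : lmodType K) (Theta : (forall i, X i) -> T) :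
    Prop :=
  multilinear Theta /\
  forall (W : lmodType K) (Phi : (forall i, X i) -> W), multilinear Phi ->
    exists! phi : {linear T -> W}, Phi = phi \o Theta.

End TensorProduct.

Section CanonicalMap.
Variables (K : fieldType) (I : Type) (X Y : I -> lmodType K).
Variables (TX : lmodType K) (ThetaX : (forall i, X i) -> TX).
Variables (TY : lmodType K) (ThetaY : (forall i, Y i) -> TY).
Variables (TL : lmodType K) (ThetaL : (forall i, {linear X i -> Y i}) -> TL).
Hypotheses (TX_tensor : is_tensor_product ThetaX)
  (TY_tensor : is_tensor_product ThetaY)
  (TL_tensor : is_tensor_product ThetaL).

Let apply_with (T : forall i, {linear X i -> Y i}) (x : forall i, X i)
    (i : I) (f : {linear X i -> Y i}) (v : X i) :
  (fun j => dfwith (I := {classic I}) T i f j (dfwith (I := {classic I}) x i v j))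
  = dfwith (I := {classic I}) (fun j => T j (x j)) i (f v).
Proof.
apply: functional_extensionality_dep => j.
case: (eqVneq (i : {classic I}) j) => [<-|ij]; first by rewrite !dfwithin.
by rewrite !dfwithout.
Qed.

Let dfwith_same (J : I -> Type) (x : forall i, J i) (i : I) :
  dfwith (I := {classic I}) x i (x i) = x.
Proof.
apply: functional_extensionality_dep => j.
case: (eqVneq (i : {classic I}) j) => [<-|ij]; first by rewrite dfwithin.
by rewrite dfwithout.
Qed.

Lemma canonical_map_exists_unique : exists! Psi : {linear TL -> {linear TX -> TY}},
  forall (T : forall i, {linear X i -> Y i}) (x : forall i, X i),
    Psi (ThetaL T) (ThetaX x) = ThetaY (fun i => T i (x i)).
Proof.
case: TX_tensor => _ liftX; case: TY_tensor => mY _.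
have lin_eq (f g : {linear TX -> TY}) : f \o ThetaX = g \o ThetaX -> f = g.
  move=> fg; have mf : multilinear (f \o ThetaX).
    move=> x i a u v /=; case: TX_tensor => + _ => /(_ x i a u v) ->.
    exact: linearP.
  by have [h [_ hu]] := liftX _ _ mf; rewrite -(hu f erefl) (hu g fg).
have mT (T : forall i, {linear X i -> Y i}) :
    multilinear (fun x => ThetaY (fun i => T i (x i))).
  move=> x i a u v; pose y j := T j (x j).
  have E w : (fun j => T j (dfwith (I := {classic I}) x i w j))
      = dfwith (I := {classic I}) y i (T i w).
    by rewrite -(apply_with T x (T i) w) dfwith_same.
  by rewrite !E linearP; exact: mY.
pose Phi T := projT1 (cid (liftX _ _ (mT T))) : {linear TX -> TY}.
have PhiE T x : Phi T (ThetaX x) = ThetaY (fun i => T i (x i)).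
  have [+ _] := projT2 (cid (liftX _ _ (mT T))).
  by move=> /(congr1 (fun f : (forall i, X i) -> TY => f x)) ->.
have mPhi : multilinear Phi.
  move=> T i a f g; apply: lin_eq; apply/funext => x /=.
  have := mY (fun j => T j (x j)) i a (f (x i)) (g (x i)).
  rewrite -[_ *: _ + _ in LHS]/((a *: f + g) (x i)) -!apply_with dfwith_same.
  by rewrite !PhiE.
case: TL_tensor => mL /(_ _ _ mPhi)[Psi [PsiE Psiu]].
exists Psi; split=> [T x|Psi' Psi'E].
  by rewrite -PhiE PsiE.
apply: Psiu; apply/funext => T; apply: lin_eq; apply/funext => x /=.
by rewrite Psi'E PhiE.
Qed.

End CanonicalMap.

(* Main.v *)
Require Import Defs.
From HB Require Import structures.
From mathcomp Require Import all_boot all_order all_algebra.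
From mathcomp Require Import all_classical reals prodnormedzmodule complex.

(* Write an element of the kernel as a finite sum of [c_k ThetaL (T^k)] with all
   coordinates of all the [T^k] nonzero, and call two families equivalent when
   they differ at finitely many indices. A vector space over an infinite field
   is not a finite union of proper subspaces, so some family [x0] satisfies
   [T^k x0 ~ T^l x0] only if [T^k ~ T^l]. For a family [y0], the product of
   functionals [f_i] with [f_i (y0 i) = 1] for almost all [i], extended by [0]
   outside the class of [y0], is multilinear; applied with [y0 = T^k x] where
   [x ~ x0], it isolates the terms of one class. These terms agree outside a
   finite set [F], and there the functionals [h |-> f (h x)] separate the
   points of [L(X_i; Y_i)], which forces the sum over each class to vanish. *)

Set Implicit Arguments.
Unset Strict Implicit.
Unset Printing Implicit Defensive.

Import GRing.Theory Num.Theory.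
Local Open Scope classical_set_scope.
Local Open Scope ring_scope.

(** * Separating functionals and vectors in general position *)

(** Zorn's lemma gives a maximal subspace [N] containing [S] and avoiding [y]. It is a hyperplane
    complementing the line of [y], and [f v] is the unique [a] with [v - a *: y] in [N]. *)
Lemma scalar_separates (K : fieldType) (V : lmodType K) (S : set V) (y : V) :
  S 0 -> (forall a u v, S u -> S v -> S (a *: u + v)) -> ~ S y ->
  exists f : {scalar V}, f y = 1 /\ forall v, S v -> f v = 0.
Proof.
move=> S0 SP Sy.
(* Adjoining [S] makes [P] hold for the empty set, the union of the empty chain. *)
pose P A := (forall a u v, (A `|` S) u -> (A `|` S) v -> (A `|` S) (a *: u + v))
  /\ ~ (A `|` S) y.
have [|M [[NP Ny] maxM]] := @Zorn_bigcup V P.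
  move=> F FP totF; split=> [a u v|[[A FA Ay]|//]]; last first.
    by have [_] := FP _ FA; apply; left.
  move=> [[A FA Au]|Su] [[B FB Bv]|Sv].
  - have [AB|BA] := totF A B FA FB.
      have [/(_ a u v)[||Buv|]] := FP B FB; [left; exact: AB|by left| |by right].
      by left; exists B.
    have [/(_ a u v)[||Auv|]] := FP A FA; [by left|left; exact: BA| |by right].
    by left; exists A.
  - have [/(_ a u v)[||Auv|]] := FP A FA; [by left|by right| |by right].
    by left; exists A.
  - have [/(_ a u v)[||Buv|]] := FP B FB; [by right|by left| |by right].
    by left; exists B.
  - by right; exact: SP.
set N := M `|` S in NP Ny.
have N0 : N 0 by right.
have NZ a u : N u -> N (a *: u) by move=> Nu; rewrite -[_ *: _]addr0; exact: NP.
have NB u v : N u -> N v -> N (u - v).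
  by move=> Nu Nv; rewrite addrC -scaleN1r; exact: NP.
have exf v : exists a, N (v - a *: y).
  apply: contrapT => nex.
  (* [B] is [N] plus the line of [v]: it properly contains [M] and, as no [v - a *: y] lies in [N],
     still avoids [y], against maximality. *)
  pose B : set V := [set w | exists b, N (w - b *: v)].
  have SB : S `<=` B by move=> s Ss; exists 0; rewrite scale0r subr0; right.
  apply: (maxM B).
    split=> [m Mm|]; first by exists 0; rewrite scale0r subr0; left.
    move=> /(_ v)BM; apply: nex; exists 0; rewrite scale0r subr0; left.
    by apply: BM; exists 1; rewrite scale1r subrr.
  rewrite /P setUidl//; split=> [a u w [b Nb] [c Nc]|[b Nb]].
    exists (a * b + c); rewrite scalerDl -scalerA opprD addrACA -scalerBr.
    exact: NP.
  have [b0|b0] := eqVneq b 0; first by move: Nb; rewrite b0 scale0r subr0.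
  apply: nex; exists b^-1; rewrite -[v in N (v - _)]scale1r -(mulVf b0) -scalerA.
  by rewrite -scalerBr -opprB scalerN -scaleNr; exact: NZ.
pose f v := projT1 (cid (exf v)).
have fN v : N (v - f v *: y) := projT2 (cid (exf v)).
have fE v a : N (v - a *: y) -> f v = a.
  move=> Na; apply/eqP; rewrite -subr_eq0; apply/negP => /negP fa0; apply: Ny.
  rewrite -[y]scale1r -(mulVf fa0) -scalerA; apply: NZ.
  suff -> : (f v - a) *: y = (v - a *: y) - (v - f v *: y) by exact: NB.
  by rewrite scalerBl opprB [RHS]addrC addrA subrK.
have flin : scalar f.
  move=> a u v; apply: fE; rewrite scalerDl -scalerA opprD addrACA -scalerBr.
  exact: NP.
pose fL : {scalar V} := HB.pack f (GRing.isLinear.Build K V K *%R f flin).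
exists fL; split=> [|v Sv] /=.
  by apply: fE; rewrite scale1r subrr.
by apply: fE; rewrite scale0r subr0; right.
Qed.

Lemma scalar_eq1 (K : fieldType) (V : lmodType K) (y : V) :
  y != 0 -> exists f : {scalar V}, f y = 1.
Proof.
move=> /eqP y0.
have [//|a u v -> ->||f [fy _]] := @scalar_separates K V [set 0] y; last by exists f.
  by rewrite scaler0 addr0.
by [].
Qed.

(** The pairs in [b] form a finite-rank operator fixing every vector of [vs], with functionals from
    [G] itself and not only from its span. A new vector [u] costs a rank-one correction along its
    residual [r], using some [p] in [G] with [p r != 0]. *)
Lemma separating_expansion (K : fieldType) (V : lmodType K)
    (G : set {scalar V}) (vs : seq V) :
  (forall v, (forall p, G p -> p v = 0) -> v = 0) ->
  exists b : seq ({p : {scalar V} | G p} * V),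
    forall v, v \in vs -> v = \sum_(q <- b) sval q.1 v *: q.2.
Proof.
move=> Gsep; elim: vs => [|u vs [b bE]]; first by exists [::].
pose r := u - \sum_(q <- b) sval q.1 u *: q.2.
have [r0|r0] := eqVneq r 0.
  exists b => v /[!inE] /orP[/eqP ->|/bE//].
  by apply/eqP; rewrite -subr_eq0; apply/eqP.
have [p [Gp pr0]] : exists p : {scalar V}, G p /\ p r != 0.
  apply: contrapT => np; move/eqP: r0; apply; apply: Gsep => p Gp.
  by apply/eqP/negPn/negP => pr; apply: np; exists p.
exists ((exist _ p Gp, (p r)^-1 *: r) ::
  [seq (q.1, q.2 - (p q.2 / p r) *: r) | q <- b]) => v vin.
pose rv := v - \sum_(q <- b) sval q.1 v *: q.2.
(* The residual is zero for the earlier vectors and [r] for [u], so both cases have this form. *)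
have rvE : rv = (p rv / p r) *: r.
  move: vin; rewrite inE => /orP[/eqP vu|/bE vE].
    by rewrite /rv vu -/r mulfV// scale1r.
  by rewrite /rv -vE subrr linear0 mul0r scale0r.
rewrite big_cons big_map /=.
under eq_bigr do rewrite scalerBr scalerA.
rewrite big_split /= sumrN -scaler_suml addrCA scalerA -scalerBl.
apply/eqP; rewrite eq_sym -subr_eq0 addrAC -opprB -/rv addrC subr_eq0.
have prv : p rv = p v - \sum_(q <- b) sval q.1 v * p q.2.
  by rewrite linearB linear_sum; under [in LHS]eq_bigr do rewrite linearZ.
rewrite [X in _ == X]rvE prv mulrBl mulr_suml; apply/eqP; congr ((_ - _) *: _).
by apply: eq_bigr => q _; rewrite mulrA.
Qed.

(* On a line [x + t u] not contained in the kernel of [f j], at most one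
   parameter is bad, so all large integers [t] are good. *)
Lemma linear_avoid (K : numFieldType) (V W : lmodType K) (J : eqType)
    (f : J -> {linear V -> W}) (s : seq J) :
  exists x, forall j, j \in s -> (exists u, f j u != 0) -> f j x != 0.
Proof.
elim: s => [|k s [x xP]]; first by exists 0.
have [[u fu]|nu] := pselect (exists u, f k u != 0); last first.
  by exists x => j /[!inE] /orP[/eqP ->|/xP].
have large j : f j x != 0 \/ f j u != 0 ->
    exists N, forall t, (N <= t)%N -> f j (x + t%:R *: u) != 0.
  move=> xu; have [[t0 /eqP ft0]|nt] := pselect (exists t, f j (x + t%:R *: u) == 0).
    exists t0.+1 => t t0t; apply/eqP => ft.
    have E m : f j (x + m%:R *: u) = f j x + m%:R *: f j u.
      by rewrite linearD linearZ.
    (* Two bad parameters would force [f j u = 0], then [f j x = 0]. *)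
    have : (t - t0)%:R *: f j u = 0.
      rewrite natrB 1?ltnW// scalerBl -(addrKA (f j x)) [X in X - _]addrC -!E.
      by rewrite ft ft0 subr0.
    move=> /eqP; rewrite scaler_eq0 pnatr_eq0 subn_eq0 leqNgt t0t /=.
    move=> /eqP fu0; move: xu ft0; rewrite E fu0 scaler0 addr0 => xu fx0.
    by move: xu; rewrite fx0 eqxx => -[].
  by exists 0%N => t _; apply/negP => ft; apply: nt; exists t.
have [N NP] : exists N, forall t, (N <= t)%N ->
    forall j, j \in k :: s -> (exists v, f j v != 0) -> f j (x + t%:R *: u) != 0.
  have lk := large k (or_intror fu).
  have {xP} : forall j, j \in k :: s -> (exists v, f j v != 0) ->
      exists N, forall t, (N <= t)%N -> f j (x + t%:R *: u) != 0.
    by move=> j /[!inE] /orP[/eqP ->//|js fj]; apply: large; left; exact: xP.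
  elim: (k :: s) => [|i l IHl] lP; first by exists 0%N.
  have [|N NP] := IHl; first by move=> j jl; apply: lP; rewrite inE jl orbT.
  have [fi|nfi] := pselect (exists v, f i v != 0); last first.
    by exists N => t Nt j /[!inE] /orP[/eqP ->//|/NP]; exact.
  have [M MP] := lP i (mem_head _ _) fi.
  exists (maxn M N) => t; rewrite geq_max => /andP[Mt Nt] j.
  by rewrite inE => /orP[/eqP -> _|/NP]; [exact: MP|exact].
by exists (x + N%:R *: u); exact: NP.
Qed.

(** * Vanishing criteria for finite sums *)

(** Induction on [F]: expanding coordinate [i] by [separating_expansion] replaces [x k i] by vectors
    [w] independent of [k], while the scalars [p (x k i)] join the coefficients. Once [F] is empty,
    all the families coincide and the hypothesis says that the coefficients sum to zero. *)
Lemma multilinear_sum_eq0 (K : fieldType) (I : Type) (V : I -> lmodType K)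
    (G : forall i, set {scalar V i})
    (Gsep : forall i v, (forall p, G i p -> p v = 0) -> v = 0)
    (W : lmodType K) (Phi : (forall i, V i) -> W) (Phi_ml : multilinear Phi)
    (F : seq {classic I}) (J : finType) (A : pred J) (c : J -> K)
    (x : J -> forall i, V i) :
  uniq F -> (forall k l i, A k -> A l -> i \notin F -> x k i = x l i) ->
  (forall q : forall i, {scalar V i}, (forall i, i \in F -> G i (q i)) ->
    \sum_(k | A k) c k * \prod_(i <- F) q i (x k i) = 0) ->
  \sum_(k | A k) c k *: Phi (x k) = 0.
Proof.
elim: F c x => [|i F IHF] c x /=.
  move=> _ xE /(_ (fun=> \0)) sum0.
  have [k0 k0A|A0] := pickP A; last by rewrite big_pred0.
  rewrite (eq_bigr (fun k => c k *: Phi (x k0))).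
    rewrite -scaler_suml (_ : \sum_(k | A k) c k = 0) ?scale0r//.
    by rewrite -[RHS]sum0//; apply: eq_bigr => k _; rewrite big_nil mulr1.
  by move=> k kA; congr (_ *: Phi _); apply: functional_extensionality_dep => i; exact: xE.
move=> /andP[iF uF] xE sum0.
have [b bE] := separating_expansion [seq x k i | k <- enum J] (@Gsep i).
pose xw k w := dfwith (I := {classic I}) (x k) i w.
have xx k : xw k (x k i) = x k.
  apply: functional_extensionality_dep => j; rewrite /xw.
  have [<-|ij] := eqVneq (i : {classic I}) j; first by rewrite dfwithin.
  by rewrite dfwithout.
have PhiE k : Phi (x k) = \sum_(q <- b) sval q.1 (x k i) *: Phi (xw k q.2).
  pose L : {linear V i -> W} :=
    HB.pack (fun v => Phi (xw k v)) (GRing.isLinear.Build K _ _ _ _ (Phi_ml (x k) i)).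
  rewrite -[in LHS]xx -[LHS]/(L (x k i)) {1}(bE (x k i)); last first.
    by apply: map_f; rewrite mem_enum.
  by rewrite linear_sum; apply: eq_bigr => q _; rewrite linearZ.
under eq_bigr do rewrite PhiE scaler_sumr.
rewrite exchange_big /= big1// => -[p w] _ /=.
under eq_bigr do rewrite scalerA.
apply: (IHF (fun k => c k * sval p (x k i)) (fun k => xw k w)) => //.
  move=> k l j kA lA jF; rewrite /xw.
  have [<-|ij] := eqVneq (i : {classic I}) j; first by rewrite !dfwithin.
  by rewrite !dfwithout// (xE k l)// inE negb_or eq_sym ij.
move=> q qG; rewrite -[RHS](sum0 (dfwith (I := {classic I}) q i (sval p))).
  apply: eq_bigr => k _; rewrite big_cons dfwithin mulrA; congr (_ * _).
  apply: eq_big_seq => j jF.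
  have ij : (i : {classic I}) != j by apply: contraNneq iF => ->.
  by rewrite /xw !dfwithout.
move=> j; rewrite inE => /predU1P[->|jF]; first by rewrite dfwithin; exact: (svalP p).
have ij : (i : {classic I}) != j by apply: contraNneq iF => ->.
by rewrite dfwithout//; exact: qG.
Qed.

Lemma sum_equivalence_classes_eq0 (V : nmodType) (J : finType) (e : rel J)
    (F : J -> V) :
  equivalence_rel e -> (forall k, \sum_(l | e k l) F l = 0) -> \sum_k F k = 0.
Proof.
(* The pick depends only on the predicate, so equivalent elements get the same representative. *)
move=> eqe F0; pose repr k := [pick l | e k l].
rewrite (partition_big repr predT)//= big1// => j _.
have [k0 /eqP rk0|nj] := pickP (fun k => repr k == j); last by rewrite big_pred0.
rewrite -[RHS](F0 k0); apply: eq_bigl => k; rewrite -rk0; apply/eqP/idP => [|k0k].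
  rewrite /repr; case: pickP => [l kl|/(_ k)]; last by rewrite (eqe k k k).1.
  case: pickP => // m k0m [lm]; rewrite lm in kl.
  by rewrite ((eqe k0 m k).2 k0m) -((eqe k m k).2 kl) (eqe k k k).1.
by apply: eq_pick => l; rewrite ((eqe k0 k l).2 k0k).
Qed.

(** * Spanning and product functionals for infinite tensor products *)

(** Otherwise some functional vanishes on the span but not at [z]; it and [\0] both factor the zero
    multilinear map, against uniqueness. *)
Lemma tensor_spanned (K : fieldType) (I : Type) (X : I -> lmodType K)
    (TX : lmodType K) (Theta : (forall i, X i) -> TX) (z : TX) :
  is_tensor_product Theta ->
  exists s : seq (K * (forall i, X i)), z = \sum_(p <- s) p.1 *: Theta p.2.
Proof.
move=> [_ lift].
pose S := [set z | exists s : seq (K * (forall i, X i)),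
  z = \sum_(p <- s) p.1 *: Theta p.2].
apply: contrapT => /(@scalar_separates K TX S)[].
- by exists [::]; rewrite big_nil.
- move=> a _ _ [s ->] [t ->]; exists ([seq (a * p.1, p.2) | p <- s] ++ t).
  rewrite big_cat big_map scaler_sumr; congr (_ + _).
  by apply: eq_bigr => p _; rewrite scalerA.
move=> f [fz fS].
have [|g [_ gu]] := lift K^o (fun=> 0).
  by move=> x i a u v; rewrite scaler0 addr0.
have f0 : f z = 0.
  have <- : g = f :> {linear TX -> K^o}.
    apply: gu; apply/funext => x /=; rewrite fS//.
    by exists [:: (1, x)]; rewrite big_seq1 scale1r.
  by rewrite (gu (\0 : {linear TX -> K^o})).
by move: fz; rewrite f0 => /eqP; rewrite eq_sym oner_eq0.
Qed.

(* The families differing from [y0] at finitely many indices span the summand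
   of the infinite tensor product on which this functional lives. *)
Definition component_product (K : fieldType) (I : Type) (Y : I -> lmodType K)
    (f : forall i, {scalar Y i}) (y0 y : forall i, Y i) : K^o :=
  if `[< finite_set [set i | y i <> y0 i] >] then
    \big[*%R/1]_(i \in [set: {classic I}]) f i (y i)
  else 0.

Lemma component_product_seq (K : fieldType) (I : Type) (Y : I -> lmodType K)
    (f : forall i, {scalar Y i}) (y0 y : forall i, Y i) (F : seq {classic I}) :
  uniq F -> (forall i, i \notin F -> y i = y0 i /\ f i (y0 i) = 1) ->
  component_product f y0 y = \prod_(i <- F) f i (y i).
Proof.
move=> uF yF; rewrite /component_product ifT; last first.
  apply/asboolP; apply: (@sub_finite_set {classic I} _ [set` F]) (finite_seq F).
  by move=> i /= yi; apply/negPn/negP => /yF[].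
rewrite [RHS]fsbig_seq//; apply/esym; apply: fsbig_widen => // i [_ /= /negP/yF[-> ->]].
by [].
Qed.

(** Changing one coordinate never leaves or enters the class of [y0]. Inside the class the
    hypothesis makes almost all factors 1, so the product is a genuine finite one; an infinite
    support would give the default value 1. *)
Lemma multilinear_component_product (K : fieldType) (I : Type)
    (Y : I -> lmodType K) (f : forall i, {scalar Y i}) (y0 : forall i, Y i) :
  finite_set [set i | f i (y0 i) <> 1] -> multilinear (component_product f y0).
Proof.
move=> fin1 y i a u v.
pose D : set {classic I} := [set j | y j <> y0 j].
have [finD|infD] := pselect (finite_set D); last first.
  have infw w : component_product f y0 (dfwith (I := {classic I}) y i w) = 0.
    rewrite /component_product ifF//; apply/asboolPn => finw; apply: infD.
    apply: (@sub_finite_set _ _ ([set i : {classic I}] `|` _)); last first.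
      by rewrite finite_setU; split; [exact: finite_set1|exact: finw].
    move=> j Dj; have [<-|ij] := eqVneq (i : {classic I}) j; first by left.
    by right; rewrite /= dfwithout.
  by rewrite !infw scaler0 addr0.
(* Off [E] every factor is 1 whatever [w] is; [i] is added so that its factor splits off and leaves
   [c] independent of [w]. *)
pose E : set {classic I} := D `|` [set j | f j (y0 j) <> 1] `|` [set i : {classic I}].
have finE : finite_set E by rewrite !finite_setU; split; [split|exact: finite_set1].
pose c := \big[*%R/1]_(j \in E `\ (i : {classic I})) f j (y j).
suff linw w : component_product f y0 (dfwith (I := {classic I}) y i w) = f i w * c.
  by rewrite !linw linearP mulrDl -mulrA.
have wE j : ~ E j -> dfwith (I := {classic I}) y i w j = y0 j /\ f j (y0 j) = 1.
  move=> nE; have ij : (i : {classic I}) != j.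
    by apply/eqP => ij; apply: nE; right.
  rewrite dfwithout//; split; apply: contrapT => nj; apply: nE; left.
    by left.
  by right.
rewrite /component_product ifT; last first.
  apply/asboolP; apply: (@sub_finite_set {classic I} _ E) finE => j /= wj.
  by apply: contrapT => /wE[].
rewrite -(fsbig_widen E)//; last by move=> j [_ /wE[/= -> ->]].
rewrite (fsbigD1 (i : {classic I}))//=; last by right.
rewrite dfwithin; congr (_ * _); apply: eq_fsbigr => j; rewrite inE => -[_ /= ji].
by rewrite dfwithout//; apply/eqP => ij; apply: ji.
Qed.

(** * Separation for families of linear maps *)

Lemma linear_neq0P (K : comNzRingType) (V W : lmodType K) (f : {linear V -> W}) :
  f != 0 -> exists u, f u != 0.
Proof.
move=> /eqP f0; apply: contrapT => nu; apply: f0; apply: linear_ext => u /=.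
by apply/eqP/negPn/negP => fu; apply: nu; exists u.
Qed.

Lemma exists_separating_family (K : numFieldType) (I : Type)
    (X Y : I -> lmodType K) (J : finType)
    (T : J -> forall i, {linear X i -> Y i}) :
  exists x : forall i, X i, forall i,
    (forall k, T k i != 0 -> T k i (x i) != 0) /\
    (forall k l, T k i (x i) = T l i (x i) -> T k i = T l i).
Proof.
suff ex i : exists v : X i, (forall k, T k i != 0 -> T k i v != 0) /\
    (forall k l, T k i v = T l i v -> T k i = T l i).
  by exists (fun i => projT1 (cid (ex i))) => i; case: (cid (ex i)).
(* [None] encodes the map [T k i] itself, [Some l] the difference [T k i - T l i]. *)
pose f (p : J * option J) : {linear X i -> Y i} :=
  if p.2 is Some l then T p.1 i - T l i else T p.1 i.
have [v vP] := linear_avoid f (enum {: J * option J}).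
exists v; split=> [k /linear_neq0P Tk|k l Tkl].
  by have := vP (k, None); rewrite mem_enum; exact.
apply/eqP; rewrite -subr_eq0; apply/negPn/negP => /linear_neq0P Tk.
have := vP (k, Some l); rewrite mem_enum /= => /(_ isT Tk).
by rewrite -[X in X != 0]/(T k i v - T l i v) Tkl subrr eqxx.
Qed.

Lemma multilinear_eq0 (K : fieldType) (I : Type) (X : I -> lmodType K)
    (W : lmodType K) (Phi : (forall i, X i) -> W) (x : forall i, X i) (i : I) :
  multilinear Phi -> x i = 0 -> Phi x = 0.
Proof.
move=> ml xi0.
have xE : dfwith (I := {classic I}) x i (0 : X i) = x.
  apply: functional_extensionality_dep => j.
  have [<-|ij] := eqVneq (i : {classic I}) j; first by rewrite dfwithin xi0.
  by rewrite dfwithout.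
by have := ml x i (-1) 0 0; rewrite scaleN1r oppr0 addr0 xE scaleN1r addNr.
Qed.

(** Applying a family of maps to a point [x] and then a product functional on the target amounts to
    a product of these functionals. *)
Definition evaluation_scalars (K : fieldType) (V W : lmodType K) :
    set {scalar {linear V -> W}} :=
  [set p : {scalar {linear V -> W}} | exists (x : V) (f : {scalar W}),
    forall h : {linear V -> W}, p h = f (h x)].

Lemma evaluation_scalars_separate (K : fieldType) (V W : lmodType K)
    (g : {linear V -> W}) :
  (forall p, evaluation_scalars p -> p g = 0) ->
  g = 0.
Proof.
move=> g0; apply/eqP/negPn/negP => /linear_neq0P[x /scalar_eq1[f fgx]].
have plin : scalar (fun h : {linear V -> W} => f (h x)).
  by move=> a h1 h2; exact: linearP.
pose p : {scalar {linear V -> W}} := HB.pack (fun h : {linear V -> W} => f (h x))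
  (GRing.isLinear.Build K _ K *%R _ plin).
have /(g0 p) : evaluation_scalars p.
  by exists x, f.
by rewrite -[p g]/(f (g x)) fgx => /eqP; rewrite oner_eq0.
Qed.

(** * Injectivity of the canonical map *)

(** The last hypothesis is what a kernel element of [Psi] satisfies. The sum is shown to vanish
    class by class, with [f], [y0] and [x] chosen to kill all the other classes. *)
Lemma sum_tensor_eq0 (K : numFieldType) (I : Type) (X Y : I -> lmodType K)
    (TL : lmodType K) (ThetaL : (forall i, {linear X i -> Y i}) -> TL)
    (J : finType) (c : J -> K) (T : J -> forall i, {linear X i -> Y i}) :
  multilinear ThetaL -> (forall k i, T k i != 0) ->
  (forall (f : forall i, {scalar Y i}) (y0 : forall i, Y i) (x : forall i, X i),
    finite_set [set i | f i (y0 i) <> 1] ->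
    \sum_k c k * component_product f y0 (fun i => T k i (x i)) = 0) ->
  \sum_k c k *: ThetaL (T k) = 0.
Proof.
move=> mL T0 sum0.
pose e k l := `[< finite_set [set i | T k i <> T l i] >].
have e_sym k l : e k l -> e l k.
  move=> /asboolP kl; apply/asboolP; apply: sub_finite_set kl => i /= lk kl.
  by apply: lk; rewrite kl.
have e_trans k l m : e k l -> e l m -> e k m.
  move=> /asboolP kl /asboolP lm; apply/asboolP.
  apply: (@sub_finite_set _ _ ([set i | T k i <> T l i] `|` [set i | T l i <> T m i])).
    move=> i /= km; have [kli|kli] := pselect (T k i = T l i); last by left.
    by right; rewrite -kli.
  by rewrite finite_setU.
apply: (sum_equivalence_classes_eq0 (e := e)) => [k l m|k0].
  split=> [|kl]; first by apply/asboolP; rewrite (_ : [set _ | _] = set0)// -subset0.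
  by apply/idP/idP; apply: e_trans => //; exact: e_sym.
pose D : set {classic I} := \bigcup_(k in [set k | e k0 k]) [set i | T k i <> T k0 i].
have finD : finite_set D.
  by apply: bigcup_finite => // k /= /e_sym/asboolP.
have [F uF DF] : exists2 F : seq {classic I}, uniq F & D = [set` F].
  have [F ->] := (finite_seqP D).1 finD.
  exists (undup F); first exact: undup_uniq.
  by apply/seteqP; split=> i /=; rewrite mem_undup.
have TF k i : e k0 k -> i \notin F -> T k i = T k0 i.
  move=> k0k iF; apply: contrapT => ki; move/negP: iF; apply.
  have : D i by exists k.
  by rewrite DF.
have [x0 x0P] := exists_separating_family T.
have Gsep i (h : {linear X i -> Y i}) :
    (forall p, evaluation_scalars p -> p h = 0) -> h = 0.
  exact: evaluation_scalars_separate.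
apply: (multilinear_sum_eq0 Gsep mL uF).
- by move=> k l i k0k k0l iF; rewrite (TF k)// (TF l).
move=> q qF.
(* On [F] the data realise [q i] as an evaluation; off [F] the point is [x0 i] and the functional is
   normalised at [T k0 i (x0 i)], which is nonzero because [T k0 i] is. *)
have exf i : exists xf : X i * {scalar Y i},
    (i \in F -> forall h : {linear X i -> Y i}, q i h = xf.2 (h xf.1)) /\
    (i \notin F -> xf.1 = x0 i /\ xf.2 (T k0 i xf.1) = 1).
  have [/qF[x [f qE]]|iF] := boolP ((i : {classic I}) \in F); first by exists (x, f).
  have [f fE] := scalar_eq1 ((x0P i).1 k0 (T0 k0 i)).
  by exists (x0 i, f).
pose x i := (projT1 (cid (exf i))).1.
pose f i := (projT1 (cid (exf i))).2.
have qE i (h : {linear X i -> Y i}) : i \in F -> q i h = f i (h (x i)).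
  by rewrite /f /x; case: (cid (exf i)) => -[u g] /= [+ _] iF => /(_ iF).
have xE i : i \notin F -> x i = x0 i /\ f i (T k0 i (x i)) = 1.
  by rewrite /f /x; case: (cid (exf i)) => -[u g] /= [].
pose y0 i := T k0 i (x i).
have finf : finite_set [set i | f i (y0 i) <> 1].
  apply: (@sub_finite_set {classic I} _ [set` F]) (finite_seq F) => i /= fi.
  by apply/negPn/negP => /xE[].
have := sum0 f y0 x finf; rewrite (bigID (e k0)) /= [X in _ + X]big1 ?addr0.
  move=> sumE; rewrite -[RHS]sumE.
  apply: eq_bigr => k k0k; rewrite (component_product_seq (F := F))//.
    congr (_ * _); apply: eq_big_seq => i iF; exact: qE.
  by move=> i iF; rewrite (TF k)// (xE i iF).2.
(* If [T k x] were in the class of [y0], then [T k i] and [T k0 i] would agree at [x0 i] for almost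
   all [i], hence be equal there by the choice of [x0], and [k] would be in the class of [k0]. *)
move=> k nk0k; rewrite /component_product ifF ?mulr0//; apply/asboolPn => fink.
move/negP: nk0k; apply; apply/e_sym/asboolP.
apply: (@sub_finite_set _ _ ([set i | T k i (x i) <> y0 i] `|` D)); last first.
  by rewrite finite_setU.
move=> i /= ki; have [iF|iF] := boolP ((i : {classic I}) \in F).
  by right; rewrite DF.
by left; rewrite /y0 (xE i iF).1 => /(x0P i).2.
Qed.

Theorem proposition2p8 (R : realType) (I : Type)
    (I_infinite : infinite_set [set: I])
    (X Y : I -> lmodType R[i])
    (X_neq0 : forall i, exists x : X i, x != 0)
    (Y_neq0 : forall i, exists y : Y i, y != 0)
    (TX : lmodType R[i]) (ThetaX : (forall i, X i) -> TX)
    (TX_tensor : is_tensor_product ThetaX)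
    (TY : lmodType R[i]) (ThetaY : (forall i, Y i) -> TY)
    (TY_tensor : is_tensor_product ThetaY)
    (TL : lmodType R[i]) (ThetaL : (forall i, {linear X i -> Y i}) -> TL)
    (TL_tensor : is_tensor_product ThetaL)
    (Psi : {linear TL -> {linear TX -> TY}})
    (PsiE : forall (T : forall i, {linear X i -> Y i}) (x : forall i, X i),
      Psi (ThetaL T) (ThetaX x) = ThetaY (fun i => T i (x i))) :
  injective Psi.
Proof.
move=> z1 z2 Pz; apply/eqP; rewrite -subr_eq0; apply/eqP; set z := z1 - z2.
have Psiz : Psi z = 0 by rewrite linearB Pz subrr.
have [mL _] := TL_tensor.
have [s0 zE0] := tensor_spanned z TL_tensor.
(* Terms with a zero coordinate vanish by multilinearity; in the others, functionals can be
   normalised at every index. *)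
pose s := [seq p <- s0 | `[< forall i, p.2 i != 0 >]].
have zE : z = \sum_(p <- s) p.1 *: ThetaL p.2.
  rewrite zE0 big_filter [RHS]big_mkcond; apply: eq_bigr => p _; case: asboolP => // nT.
  have [i pi0] : exists i, p.2 i = 0.
    apply: contrapT => np; apply: nT => i; apply/eqP => pi0; apply: np.
    by exists i.
  by rewrite (multilinear_eq0 mL pi0) scaler0.
rewrite zE big_tnth; apply: sum_tensor_eq0 => //.
  move=> k; have : all (fun p => `[< forall i, p.2 i != 0 >]) s by exact: filter_all.
  by move=> /(all_tnthP (t := in_tuple s))/(_ k)/asboolP.
move=> f y0 x fin1.
(* Followed by the functional [g] that [component_product f y0] induces on [TY], [L] kills [z] and
   sends each [ThetaL T] to the required component product. *)
pose L : {linear TL -> TY} := HB.pack (fun w => Psi w (ThetaX x))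
  (GRing.isLinear.Build R[i] TL TY *:%R (fun w => Psi w (ThetaX x))
    (fun a u v => congr1 (fun g : {linear TX -> TY} => g (ThetaX x)) (linearP Psi a u v))).
have [_ liftY] := TY_tensor.
have [g [gE _]] := liftY _ _ (multilinear_component_product fin1).
have : g (L z) = 0.
  by rewrite -[L z]/(Psi z (ThetaX x)) Psiz; exact: linear0.
rewrite zE big_tnth !linear_sum => sum0; rewrite -[RHS]sum0; apply: eq_bigr => k _.
rewrite !linearZ gE; congr (_ * _).
by rewrite -[L _]/(Psi _ (ThetaX x)) PsiE.
Qed.
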